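(* Let $X$ be a Peano continuum without cut points, let $G$ be a group acting by homeomorphisms on $X$, and let $\mathcal{A}$ be a $G$-invariant collection of closed subsets of $X$ such that $(G,\mathcal{A})$ is a fine pairing on $X$. If, for each $A \in \mathcal{A}$, the stabilizer $\mathrm{Stab}(A)$ acts as a convergence group on $X$, then $G$ acts as a convergence group on $X$.
   Context: A Peano continuum is a compact connected locally connected metric space. A point $x\in X$ is a cut point if $X-\{x\}$ is not connected. For $A\subset X$, $\mathrm{Stab}(A)=\{g\in G : g(A)=A\}$, acting on $X$ by restriction of the action of $G$. Separation: $A\subset X$ separates the sets $B,C\subset X$ if $B$ and $C$ lie in different components of $X-A$; $A$ separates a point $x$ from a point $y$ if $x$ and $y$ lie in different components of $X-A$ (in particular $x,y\notin A$). $A$ separates points of $B$ if there are two points of $B$ that $A$ separates from each other. Crossing: closed sets $A,B\subset X$ cross if $A\cap B\neq\emptyset$, or $A$ separates points of $B$, or $B$ separates points of $A$. Fine pairing: let $G$ act by homeomorphisms on the Peano continuum $X$ and let $\mathcal{A}$ be a $G$-invariant collection of closed subsets of $X$ (i.e. $g(A)\in\mathcal{A}$ for all $g\in G$, $A\in\mathcal{A}$). The pair $(G,\mathcal{A})$ is a fine pairing on $X$ if: (1) $\mathcal{A}$ is cross connected: for any $A,B\in\mathcal{A}$ there are $A_1,\dots,A_n\in\mathcal{A}$ with $A_1=A$, $A_n=B$ and $A_i$ crossing $A_{i+1}$ for $0<i<n$; (2) $\mathcal{A}$ is null: for every $\epsilon>0$ the set $\{A\in\mathcal{A} : \mathrm{diam}(A)>\epsilon\}$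 is finite; (3) $\mathcal{A}$ is fine: for any distinct $x,y\in X$ there is a finite $\mathcal{B}\subset\mathcal{A}$ such that $\bigcup\mathcal{B}$ separates $x$ from $y$. Convergence group: a group $H$ acting by homeomorphisms on a space $X$ acts as a convergence group on $X$ if for each sequence of distinct elements of $H$ there are a subsequence $(g_i)$ and points $p,n\in X$ such that for any compact $C\subset X$ with $n\notin C$ and any neighborhood $U$ of $p$ there is $K\in\mathbb{N}$ such that $g_i(C)\subset U$ for all $i>K$. For $X$ compact Hausdorff this is equivalent to the following second definition: the induced action of $H$ on the space $\triangle X=\{T\subset X : |T|=3\}$ of distinct triples (topologized as a quotient of the subset of $X^3$ of triples with pairwise distinct entries by the permutation action of $S_3$) is proper, where an action on a space $Y$ is proper if for every compact $C\subset Y$ the set $\{g : g(C)\cap C\neq\emptyset\}$ is finite. *)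

(* Defs.v *)
From HB Require Import structures.
From mathcomp Require Import all_boot all_order all_algebra.
From mathcomp Require Import all_classical all_reals all_analysis.

Set Implicit Arguments.
Unset Strict Implicit.
Unset Printing Implicit Defensive.

Import Order.TTheory GRing.Theory Num.Theory.

Local Open Scope classical_set_scope.
Local Open Scope ring_scope.

Definition locally_connected (X : topologicalType) : Prop :=
  forall (x : X) (U : set X), nbhs x U ->
    exists V : set X, [/\ open V, connected V, V x & V `<=` U].

(* A continuum is nonempty by convention; for the empty space every infinite
   group would satisfy the hypotheses below but not act as a convergence
   group. *)
Definition peano_continuum (R : realType) (X : metricType R) : Prop :=
  [/\ [set: X] !=set0, compact [set: X], connected [set: X]
    & locally_connected X].

Definition cut_point (X : topologicalType) (x : X) : Prop :=
  ~ connected (~` [set x]).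

(* Continuity of every [act g] suffices for an action by homeomorphisms: the
   inverse of [act g] is [act g^-1]. *)
Record homeo_action (G : groupType) (X : topologicalType) (act : G -> X -> X) :
    Prop := HomeoAction {
  act_one : forall x, act 1%g x = x ;
  act_mul : forall (g h : G) x, act (g * h)%g x = act g (act h x) ;
  act_continuous : forall g, continuous (act g) }.

Definition stab (G : groupType) (X : Type) (act : G -> X -> X) (A : set X) :
    set G :=
  [set g | act g @` A = A].

Definition separates (X : topologicalType) (A : set X) (x y : X) : Prop :=
  [/\ ~ A x, ~ A y
    & connected_component (~` A) x <> connected_component (~` A) y].

Definition separates_points_of (X : topologicalType) (A B : set X) : Prop :=
  exists x y, [/\ B x, B y & separates A x y].

Definition cross (X : topologicalType) (A B : set X) : Prop :=
  [\/ A `&` B !=set0, separates_points_of A B | separates_points_of B A].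

(* The diameter of the empty set is [-oo] here instead of 0, which is
   immaterial since diameters are only compared with positive reals. *)
Definition diam (R : realType) (X : metricType R) (A : set X) : \bar R :=
  ereal_sup [set (mdist x y)%:E | x in A & y in A].

Definition cross_connected (X : topologicalType) (AA : set (set X)) : Prop :=
  forall A B, AA A -> AA B ->
    exists (n : nat) (C : nat -> set X),
      [/\ C 0%N = A, C n = B, (forall i, (i <= n)%N -> AA (C i))
        & (forall i, (i < n)%N -> cross (C i) (C i.+1))].

Definition null_collection (R : realType) (X : metricType R)
    (AA : set (set X)) : Prop :=
  forall e : R, 0 < e -> finite_set [set A | AA A /\ (e%:E < diam A)%E].

Definition fine_collection (X : topologicalType) (AA : set (set X)) : Prop :=
  forall x y : X, x <> y ->
    exists BB : set (set X),
      [/\ finite_set BB, BB `<=` AA & separates (\bigcup_(B in BB) B) x y].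

Record fine_pairing (R : realType) (G : groupType) (X : metricType R)
    (act : G -> X -> X) (AA : set (set X)) : Prop := FinePairing {
  fine_pairing_closed : forall A, AA A -> closed A ;
  fine_pairing_invariant : forall g A, AA A -> AA (act g @` A) ;
  fine_pairing_cross_connected : cross_connected AA ;
  fine_pairing_null : null_collection AA ;
  fine_pairing_fine : fine_collection AA }.

(* [H] is the underlying set of a subgroup of [G], acting by restriction. The
   elements of the sequence are distinct as elements of the group, so that an
   infinite kernel is not ignored. *)
Definition convergence_group (G : groupType) (X : topologicalType)
    (act : G -> X -> X) (H : set G) : Prop :=
  forall u : nat -> G, (forall i, H (u i)) -> injective u ->
    exists (k : nat -> nat) (p n : X),
      {homo k : i j / (i < j)%N} /\
      forall C U : set X, compact C -> ~ C n -> nbhs p U ->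
        exists K : nat, forall i, (K < i)%N -> act (u (k i)) @` C `<=` U.

(* Main.v *)
Require Import Defs.
From mathcomp Require Import all_boot all_order all_algebra.
From mathcomp Require Import all_classical all_reals all_analysis.

Local Open Scope classical_set_scope.

Import Order.TTheory GRing.Theory Num.Theory.

Set Implicit Arguments.
Unset Strict Implicit.
Unset Printing Implicit Defensive.

(** Let g_i be distinct elements of G.  If some A in the family has the same
    image under infinitely many g_i, these g_i lie in one coset of Stab(A), and
    the convergence property of Stab(A) transfers to that coset
    ([convergence_of_repeated_image]).

    Otherwise nullness gives diam(g_i A) -> 0 for every A ([null_shrinks]).
    After passing to a subsequence, g_i A0 tends to a point p for one A0.  Two
    sets that are tiny and near distinct points lie in disjoint connected
    sets, so they cannot cross: hence g_i A tends to the same p whenever A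
    crosses A0, and by cross connectedness for every A
    ([collapses_cross_connected]).

    Choose q <> p and pass to a subsequence with g_i^-1 q -> n.  For y <> n a
    finite union K of members of the family separates y from n, and g_i K tends
    to p.  As p is not a cut point, for every neighbourhood U of p all points
    outside U lie in one component of the complement of g_i K, once g_i K is
    close enough to p ([setC_nbhs_linked_off]).  Taking U to avoid q, that
    component contains q, hence is the image of the component of n in the
    complement of K; so g_i maps the component of y into U
    ([near_collapse_fine]).  This convergence is locally uniform off n, so
    it is uniform on compact sets avoiding n. *)

(** * Subsequences and eventual properties *)

Lemma frequently_subseq (P : nat -> nat -> Prop) :
  (forall i N, exists2 n, (N <= n)%N & P i n) ->
  exists k : nat -> nat,
    {homo k : i j / (i < j)%N} /\ forall i, P i (k i).
Proof.
move=> frP; have /choice[f fP] : forall iN : nat * nat,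
    exists n, (iN.2 <= n)%N /\ P iN.1 n.
  by case=> i N; have [n] := frP i N; exists n.
pose k := fix k i := if i is j.+1 then f (i, (k j).+1) else f (0%N, 0%N).
exists k; split; last by case=> [|i]; apply: (fP (_, _)).2.
by apply: homo_ltn => [|i]; [exact: ltn_trans | exact: (fP (_, _)).1].
Qed.

Lemma homo_ltn_ge (k : nat -> nat) :
  {homo k : i j / (i < j)%N} -> forall i, (i <= k i)%N.
Proof. by move=> kM; elim=> // i /leq_ltn_trans; apply; exact: kM. Qed.

Lemma near_subseq (k : nat -> nat) (P : nat -> Prop) :
  {homo k : i j / (i < j)%N} ->
  (\forall i \near \oo, P i) -> \forall i \near \oo, P (k i).
Proof.
move=> kM [N _ NP]; exists N => // i /= Ni.
by apply: NP; exact: leq_trans Ni (homo_ltn_ge kM i).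
Qed.

Lemma near_finite_set (T I : Type) (F : set_system T) (D : set I)
    (P : I -> T -> Prop) : Filter F -> finite_set D ->
  (forall d, D d -> \forall t \near F, P d t) ->
  \forall t \near F, forall d, D d -> P d t.
Proof.
move=> FF finD; elim/Pchoice: I => I in D P finD *.
have /finite_fsetP[E ->] := finD => EP.
exact: (@filter_bigI T I E P F FF EP).
Qed.

Lemma compact_subseq (R : realType) (X : metricType R) (x : nat -> X) :
  compact [set: X] ->
  exists (k : nat -> nat) (l : X),
    {homo k : i j / (i < j)%N} /\ x (k i) @[i --> \oo] --> l.
Proof.
move=> cX; have [l [_ xl]] := cX (x @ \oo) _ filterT.
have [k [kM kP]] : exists k : nat -> nat, {homo k : i j / (i < j)%N} /\
    forall i, ball l (i.+1%:R^-1 : R)%R (x (k i)).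
  apply: (frequently_subseq
    (P := fun i n => ball l (i.+1%:R^-1 : R)%R (x n))) => i N.
  have lB : nbhs l (ball l (i.+1%:R^-1 : R)%R).
    by apply: nbhsx_ballx; rewrite invr_gt0.
  have xN : (x @ \oo) (x @` [set n | (N <= n)%N]).
    by exists N => // n /= Nn; exists n.
  by have [_ [[n Nn <-] xn]] := xl _ _ xN lB; exists n.
exists k, l; split => //; apply/cvg_ballP => e e0.
near=> i; apply: le_ball (kP i).
near: i; have [N _ NP] := near_infty_natSinv_lt (PosNum e0).
by exists N => // i /= Ni; exact/ltW/NP.
Unshelve. all: end_near. Qed.

(** * Complements of small neighbourhoods of a noncut point *)

Section NoncutPoint.
Variables (X : topologicalType).
Hypotheses (hX : hausdorff_space X) (lcX : locally_connected X).

Lemma disjoint_connected_nbhs (x y : X) : x <> y -> exists V W : set X,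
  [/\ nbhs x V, nbhs y W, connected V, connected W & V `<=` ~` W].
Proof.
move=> /eqP xy; move: hX; rewrite open_hausdorff.
move=> /(_ x y xy)[[A B] /= [/set_mem Ax /set_mem By] [oA oB /eqP AB]].
have [V [oV cV Vx VA]] := lcX (open_nbhs_nbhs (conj oA Ax)).
have [W [oW cW Wy WB]] := lcX (open_nbhs_nbhs (conj oB By)).
exists V, W; split=> //; [exact: open_nbhs_nbhs|exact: open_nbhs_nbhs|].
move=> z /VA Az /WB Bz.
by have : (A `&` B) z by []; rewrite AB.
Qed.

(** Points joined by a connected set whose closure avoids p.  Quantifying over
    all small neighbourhoods W of p, rather than asking for one, makes the
    relation a filter statement, so that finitely many instances combine and
    [near_covering] applies. *)
Definition linked_off (p x y : X) : Prop :=
  \forall W \near powerset_filter_from (nbhs p),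
    connected_component (~` W) x y.

Lemma near_linked_off (p y : X) : y <> p ->
  \forall z \near y & W \near powerset_filter_from (nbhs p),
    connected_component (~` W) y z.
Proof.
move=> yp; have [V [W [Vy Wp cV cW VW]]] := disjoint_connected_nbhs yp.
exists (V, [set E | E `<=` W]) => /=.
  by split => //; exact: small_set_sub Wp.
move=> [z E] /= [Vz EW]; apply: (connected_component_max _ _ cV) Vz.
  exact: nbhs_singleton.
by move=> t /VW Wt /EW.
Qed.

Lemma linked_off_trans (p x y z : X) :
  linked_off p x y -> linked_off p y z -> linked_off p x z.
Proof. by apply: filterS2 => W; exact: connected_component_trans. Qed.

Lemma linked_off_sym (p x y : X) : linked_off p x y -> linked_off p y x.
Proof. by apply: filterS => W; exact: connected_component_sym. Qed.

Lemma near_linked_off_pointwise (p y : X) : y <> p ->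
  \forall z \near y, linked_off p y z.
Proof.
move=> /near_linked_off [[V E] /= [Vy pE] VE].
apply: filterS Vy => z Vz; apply: filterS pE => W EW.
exact: (VE (z, W)).
Qed.

Lemma linked_off_neq (p x y : X) : linked_off p x y -> y <> p.
Proof.
move=> + yp; rewrite yp => xp.
have [W [pW WC]] := filter_ex (filterI (near_small_set _) xp).
by apply: (connected_component_sub WC); exact: nbhs_singleton.
Qed.

(** The class of x is open by local connectedness, and closed in the
    complement of p for the same reason; that complement is connected. *)
Lemma linked_off_noncut (p x y : X) : ~ cut_point p -> x <> p -> y <> p ->
  linked_off p x y.
Proof.
move=> /contrapT cp xp yp.
suff -> : linked_off p x = ~` [set p] by [].
apply: cp.
- by exists x; exact: nbhs_singleton (near_linked_off_pointwise xp).
- exists (linked_off p x).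
    rewrite openE => z xz; have zp := linked_off_neq xz.
    apply: filterS (near_linked_off_pointwise zp) => t.
    exact: linked_off_trans.
  by rewrite setIidr // => z /linked_off_neq.
- exists (closure (linked_off p x)); first exact: closed_closure.
  apply/seteqP; split => [z xz|z [zp clz]].
    by split; [exact: linked_off_neq xz | exact: subset_closure].
  have [t [xt zt]] := clz _ (near_linked_off_pointwise zp).
  exact: linked_off_trans xt (linked_off_sym zt).
Qed.

(** The complement of the interior of U is compact and misses p, so it is
    covered by finitely many connected sets away from p, whose centres are
    pairwise linked off p. *)
Lemma setC_nbhs_linked_off (p x : X) (U : set X) : compact [set: X] ->
  ~ cut_point p -> nbhs p U -> ~ U x ->
  \forall W \near powerset_filter_from (nbhs p),
    ~` U `<=` connected_component (~` W) x.
Proof.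
move=> cX ncp Up Ux.
have xp : x <> p by move=> xp; apply: Ux; rewrite xp; exact: nbhs_singleton.
have cK : compact (~` U°).
  by apply: (subclosed_compact _ cX) => //; exact/open_closedC/open_interior.
suff : \forall W \near powerset_filter_from (nbhs p),
    ~` U° `<=` connected_component (~` W) x.
  apply: filterS => W; apply: subset_trans => z Uz /interior_subset.
  exact: Uz.
apply: (compact_near_coveringP _).1 => // y Uy.
have yp : y <> p by move=> yp; apply: Uy; rewrite yp; exact: Up.
have := linked_off_noncut ncp xp yp.
have [[V E] /= [Vy pE] VE] := near_linked_off yp => xy.
exists (V, E `&` [set W | connected_component (~` W) x y]) => /=.
  by split => //; exact: filterI.
move=> [z W] /= [Vz [EW xyW]]; apply: connected_component_trans xyW _.
exact: (VE (z, W)).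
Qed.

End NoncutPoint.

(** * Sequences of group elements that collapse sets to a point *)

Section Dynamics.
Variables (R : realType) (G : groupType) (X : metricType R).
Variables (act : G -> X -> X) (u : nat -> G).
Hypothesis act_homeo : homeo_action act.

Lemma actK g : cancel (act g) (act g^-1%g).
Proof. by move=> x; rewrite -(act_mul act_homeo) mulVg (act_one act_homeo). Qed.

Lemma actKV g : cancel (act g^-1%g) (act g).
Proof. by move=> x; rewrite -(act_mul act_homeo) mulgV (act_one act_homeo). Qed.

Lemma connected_preimage_act g (V : set X) :
  connected V -> connected (act g @^-1` V).
Proof.
move=> cV; have -> : act g @^-1` V = act g^-1%g @` V.
  apply/seteqP; split => [x Vx|_ [x Vx <-]] /=; last by rewrite actKV.
  by exists (act g x) => //; rewrite actK.
apply: connected_continuous_connected cV _.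
exact/continuous_subspaceT/(act_continuous act_homeo).
Qed.

Lemma not_cross_disjoint_connected (A B V W : set X) :
  connected V -> connected W -> V `<=` ~` W -> A `<=` V -> B `<=` W ->
  ~ cross A B.
Proof.
have nosep (C D E : set X) : connected E -> E `<=` ~` C -> D `<=` E ->
    ~ separates_points_of C D.
  move=> cE EC DE [x [y [Dx Dy [_ _]]]]; apply.
  apply: same_connected_component.
  exact: (connected_component_max (DE _ Dx) EC cE) (DE _ Dy).
move=> cV cW VW AV BW [[x [Ax Bx]]||].
- exact: VW (AV _ Ax) (BW _ Bx).
- by apply: nosep cW _ BW => x Wx /AV/VW.
- by apply: nosep cV _ AV => x /VW Wx /BW.
Qed.

Definition collapses (A : set X) (p : X) : Prop :=
  forall U, nbhs p U -> \forall i \near \oo, A `<=` act (u i) @^-1` U.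

(** The diameters of the sets [act (u i) @` A] tend to 0. *)
Definition shrinks (A : set X) : Prop :=
  forall e : R, (0 < e)%R -> \forall i \near \oo,
    forall a b, A a -> A b -> ball (act (u i) a) e (act (u i) b).

Lemma shrinks_collapses (A : set X) (a p : X) :
  shrinks A -> A a -> act (u i) a @[i --> \oo] --> p -> collapses A p.
Proof.
move=> sA Aa ap U /nbhs_ballP[e /= e0 eU].
have e20 : (0 < e / 2)%R by rewrite divr_gt0.
have /cvg_ballP/(_ _ e20) := ap.
apply: filterS2 (sA _ e20) => i sAi api b Ab.
exact/eU/(ball_split api)/sAi.
Qed.

(** If the images of B came close to a point y <> p outside U infinitely often,
    they would lie in a small connected neighbourhood of y, the images of A in
    a disjoint connected neighbourhood of p, and pulling back these
    neighbourhoods shows that A and B do not cross.  Compactness of the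
    complement of U makes the estimate uniform in y. *)
Lemma collapses_cross (A B : set X) (p : X) :
  compact [set: X] -> locally_connected X ->
  cross A B -> shrinks B -> collapses A p -> collapses B p.
Proof.
move=> cX lcX AB sB cA U Up.
have cK : compact (~` U°).
  by apply: (subclosed_compact _ cX) => //; exact/open_closedC/open_interior.
suff : \forall i \near \oo, ~` U° `<=` [set y | forall b, B b ->
    act (u i) b <> y].
  apply: filterS => i Bi b Bb; apply: (@interior_subset _ U).
  by apply: contrapT => /Bi/(_ b Bb); apply.
apply: (compact_near_coveringP _).1 => // y Uy.
have yp : p <> y by move=> py; apply: Uy; rewrite -py; exact: Up.
have [W [V [Wp Vy cW cV WV]]] :=
  disjoint_connected_nbhs (@metric_hausdorff _ _) lcX yp.
have /nbhs_ballP[e /= e0 eV] := Vy.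
have e20 : (0 < e / 2)%R by rewrite divr_gt0.
exists (ball y (e / 2)%R, [set i | A `<=` act (u i) @^-1` W] `&`
    [set i | forall a b, B a -> B b ->
      ball (act (u i) a) (e / 2) (act (u i) b)]%R) => /=.
  by split; [exact: nbhsx_ballx | exact: filterI (cA _ Wp) (sB _ e20)].
move=> [z i] /= [yz [AW sBi]] b Bb bz; rewrite -bz in yz.
apply: (not_cross_disjoint_connected (V := act (u i) @^-1` W)
  (W := act (u i) @^-1` V)) AB => //.
- exact: connected_preimage_act.
- exact: connected_preimage_act.
- by move=> t /WV.
- by move=> c Bc; apply/eV/(ball_split yz)/sBi.
Qed.

Lemma collapses_cross_connected (AA : set (set X)) (p : X) (A B : set X) :
  compact [set: X] -> locally_connected X -> cross_connected AA ->
  (forall C, AA C -> shrinks C) -> AA A -> AA B ->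
  collapses A p -> collapses B p.
Proof.
move=> cX lcX ccAA sAA AAA AAB cA.
have [m [C [C0 <- CA Cx]]] := ccAA _ _ AAA AAB.
suff : forall i, (i <= m)%N -> collapses (C i) p by exact.
elim=> [|i IH] im; first by rewrite C0.
by apply: (collapses_cross cX lcX (Cx _ im)); [exact/sAA/CA | exact/IH/ltnW].
Qed.

(** Only finitely many members of the family have diameter above a given
    bound, and the images of A eventually avoid each of them. *)
Lemma null_shrinks (AA : set (set X)) (A : set X) :
  null_collection AA -> (forall g B, AA B -> AA (act g @` B)) -> AA A ->
  (forall B, \forall i \near \oo, act (u i) @` A <> B) -> shrinks A.
Proof.
move=> nAA iAA AAA neA e e0.
(* A bound diam <= e/2 gives the strict inequality that balls require. *)
have e20 : (0 < e / 2)%R by rewrite divr_gt0.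
have : \forall i \near \oo, forall B,
    [set B | AA B /\ ((e / 2)%:E < diam B)%E] B -> act (u i) @` A <> B.
  by apply: near_finite_set => //; exact: nAA.
apply: filterS => i neAi a b Aa Ab.
have : (diam (act (u i) @` A) <= (e / 2)%:E)%E.
  rewrite leNgt; apply/negP => dA.
  by apply: (neAi (act (u i) @` A)) => //; split => //; exact: iAA.
move=> dA; rewrite ballEmdist /=.
apply: (@le_lt_trans _ _ (e / 2)%R); last by rewrite gtr_pMr // invf_lt1 // ltr1n.
rewrite -lee_fin; apply: le_trans dA; apply: ereal_sup_ubound.
by exists (act (u i) a); [exists a | exists (act (u i) b) => //; exists b].
Qed.

(** A finite union K of members of the family separates y from n, in such a way
    that whole neighbourhoods of y and n lie in different components.  If some
    z near y had [act (u i) z] outside U, then [act (u i) z] and q would both be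
    far from p, hence joined by a connected set off the image of K.  Its preimage
    would join z to [act (u i)^-1 q], which is near n. *)
Lemma near_collapse_fine (AA : set (set X)) (p q n y : X) (U : set X) :
  compact [set: X] -> locally_connected X -> ~ cut_point p ->
  (forall A, AA A -> closed A) -> fine_collection AA ->
  (forall A, AA A -> collapses A p) ->
  q <> p -> act (u i)^-1%g q @[i --> \oo] --> n -> y <> n -> nbhs p U ->
  \forall z \near y & i \near \oo, U (act (u i) z).
Proof.
move=> cX lcX ncp clAA fAA cAA qp qn yn Up.
have [BB [finBB BBA [Ky Kn sep]]] := fAA _ _ yn.
set K := \bigcup_(B in BB) B in Ky Kn sep.
have oK : open (~` K).
  by apply: closed_openC; apply: closed_bigcup => // B /BBA/clAA.
have [Vn [oVn cVn Vnn VnK]] := lcX _ _ (open_nbhs_nbhs (conj oK Kn)).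
have [Vy [oVy cVy Vyy VyK]] := lcX _ _ (open_nbhs_nbhs (conj oK Ky)).
(* Removing q from U forces q to the same side as the points outside U. *)
have Uqp : nbhs p (U `\ q).
  apply: filterI => //; apply: open_nbhs_nbhs; split; last exact/nesym.
  exact/closed_openC/accessible_closed_set1/hausdorff_accessible/metric_hausdorff.
have Uqq : ~ (U `\ q) q by move=> [_]; apply.
have WP := setC_nbhs_linked_off (@metric_hausdorff _ _) lcX cX ncp Uqp Uqq.
have [W [Wp WU]] := filter_ex (filterI (near_small_set _) WP).
have KW : \forall i \near \oo, forall B, BB B -> B `<=` act (u i) @^-1` W.
  by apply: near_finite_set => // B /BBA/cAA; exact.
have Vni : \forall i \near \oo, Vn (act (u i)^-1%g q).
  exact: qn (open_nbhs_nbhs (conj oVn Vnn)).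
exists (Vy, [set i | (forall B, BB B -> B `<=` act (u i) @^-1` W) /\
    Vn (act (u i)^-1%g q)]) => /=.
  by split; [exact: open_nbhs_nbhs | exact: filterI].
move=> [z i] /= [Vyz [KWi Vnq]]; apply: contrapT => Uz.
have /WU qz : ~ (U `\ q) (act (u i) z) by case.
have yz := connected_component_max Vyy VyK cVy Vyz.
have nq := connected_component_max Vnn VnK cVn Vnq.
apply: sep; apply: same_connected_component.
apply: connected_component_trans yz _.
apply: connected_component_trans (connected_component_sym nq).
apply: (connected_component_max
  (B := act (u i) @^-1` connected_component (~` W) q)) => //.
- move=> x /connected_component_sub Wx [B BBB Bx]; exact/Wx/(KWi B).
- exact/connected_preimage_act/component_connected.
- rewrite /= actKV; apply: connected_component_refl.
  exact: connected_component_sub (connected_component_sym qz).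
Qed.

End Dynamics.

(** * The two cases *)

Definition has_convergence_subseq (G : groupType) (X : topologicalType)
    (act : G -> X -> X) (u : nat -> G) : Prop :=
  exists (k : nat -> nat) (p n : X),
    {homo k : i j / (i < j)%N} /\
    forall C U : set X, compact C -> ~ C n -> nbhs p U ->
      exists K : nat, forall i, (K < i)%N -> act (u (k i)) @` C `<=` U.

(** With g one of the repeating elements, all [g^-1 * u i] with the repeated
    image lie in the stabilizer of A; translating their convergence data by g
    moves the attracting point to [act g p] and keeps the repelling one. *)
Lemma convergence_of_repeated_image (R : realType) (G : groupType)
    (X : metricType R) (act : G -> X -> X) (u : nat -> G) (A B : set X) :
  homeo_action act -> convergence_group act (stab act A) -> injective u ->
  (forall N, exists2 i, (N <= i)%N & act (u i) @` A = B) ->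
  has_convergence_subseq act u.
Proof.
move=> actH stabA uI uAB.
have [k [kM kAB]] :=
  frequently_subseq (P := fun _ i => act (u i) @` A = B) (fun _ => uAB).
pose g := u (k 0%N).
have kI : injective k.
  by move=> i j /eqP kij; apply/eqP; apply: contraTT kij;
     rewrite neq_ltn => /orP[] /kM; rewrite neq_ltn => ->; rewrite ?orbT.
have hst i : stab act A (g^-1 * u (k i))%g.
  rewrite /stab /=.
  have -> : act (g^-1 * u (k i))%g = act g^-1%g \o act (u (k i)).
    by apply/funext => x; rewrite (act_mul actH).
  rewrite -image_comp kAB -(kAB 0%N) -/g image_comp.
  have -> : act g^-1%g \o act g = id by apply/funext => x; exact: actK.
  by rewrite image_id.
have hI : injective (fun i => (g^-1 * u (k i))%g) by move=> i j /mulgI/uI/kI.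
have [l [p [n [lM lP]]]] := stabA _ hst hI.
exists (k \o l), (act g p), n; split=> [i j ij|C U cC Cn Up].
  exact/kM/lM.
have [K KP] := lP C _ cC Cn (act_continuous actH Up).
exists K => i /KP CU; rewrite image_subP => x Cx.
have /= := CU _ (imageP _ Cx).
by rewrite -(act_mul actH) mulgA mulgV mul1g.
Qed.

(** The attracting point is a limit of images of one point of one member of the
    family, the repelling point a limit of preimages of some q <> p. *)
Lemma convergence_of_shrinking_images (R : realType) (G : groupType)
    (X : metricType R) (act : G -> X -> X) (AA : set (set X)) (u : nat -> G) :
  peano_continuum X -> (forall x : X, ~ cut_point x) ->
  homeo_action act -> fine_pairing act AA ->
  (forall A, AA A -> shrinks act u A) ->
  has_convergence_subseq act u.
Proof.
move=> [[x0 _] cX connX lcX] nocut actH [clAA _ ccAA _ fAA] sAA.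
(* On a one-point space, a compact set missing n is empty. *)
have [[x [y xy]]|triv] := pselect (exists x y : X, x <> y); last first.
  have X1 x : x = x0 by apply: contrapT => xx0; apply: triv; exists x, x0.
  exists id, x0, x0; split => // C U _ Cn _.
  by exists 0%N => i _ _ [x Cx <-]; case: Cn; rewrite -(X1 x).
(* The empty set separates nothing in a connected space, so the sets given by
   fineness are not all empty. *)
have [A0 [a [AA0 A0a]]] : exists A a, AA A /\ A a.
  have [BB [_ BBA [_ _ sep]]] := fAA _ _ xy.
  apply: contrapT => noA; apply: sep.
  have -> : \bigcup_(B in BB) B = set0.
    by apply/seteqP; split => // a [B /BBA AAB Ba]; apply: noA; exists B, a.
  rewrite setC0; apply: same_connected_component.
  exact: (connected_component_max (B := setT)).
have [k1 [p [k1M k1p]]] := compact_subseq (fun i => act (u i) a) cX.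
have [q qp] : exists q, q <> p.
  have [xp|xp] := pselect (x = p); last by exists x.
  by exists y => yp; apply: xy; rewrite xp yp.
have [k2 [n [k2M k2n]]] := compact_subseq (fun i => act (u (k1 i))^-1%g q) cX.
pose k := k1 \o k2.
have kM : {homo k : i j / (i < j)%N} by move=> i j ij; exact/k1M/k2M.
have sk A : AA A -> shrinks act (u \o k) A.
  by move=> /sAA sA e e0; exact: near_subseq kM (sA e e0).
have cA0 : collapses act (u \o k) A0 p.
  apply: (shrinks_collapses (sk _ AA0) A0a) => U Up.
  exact: near_subseq k2M (k1p _ Up).
have cAA A : AA A -> collapses act (u \o k) A p.
  by move=> AAA; apply: (collapses_cross_connected actH cX lcX ccAA sk AA0 AAA).
exists k, p, n; split => // C U cC Cn Up.
have [K _ KP] : \forall i \near \oo, C `<=` [set z | U (act (u (k i)) z)].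
  apply: (compact_near_coveringP _).1 => // z Cz.
  have zn : z <> n by move=> zn; apply: Cn; rewrite -zn.
  exact: (near_collapse_fine actH cX lcX (nocut p) clAA fAA cAA qp k2n zn Up).
by exists K => i /ltnW Ki; rewrite image_subP; exact: KP.
Qed.

(** * Convergence of the whole group *)

Theorem mainTheorem1 (R : realType) (X : metricType R) (G : groupType)
    (act : G -> X -> X) (AA : set (set X))
    (X_peano : peano_continuum X)
    (X_nocut : forall x : X, ~ cut_point x)
    (act_homeo : homeo_action act)
    (G_fine : fine_pairing act AA)
    (stab_conv : forall A : set X, AA A -> convergence_group act (stab act A)) :
  convergence_group act [set: G].
Proof.
move=> u _ uI.
have [[A [B [AAA uAB]]]|norep] := pselect (exists A B, AA A /\
    forall N, exists2 i, (N <= i)%N & act (u i) @` A = B).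
  exact: convergence_of_repeated_image act_homeo (stab_conv _ AAA) uI uAB.
apply: (convergence_of_shrinking_images X_peano X_nocut act_homeo G_fine).
move=> A AAA; have [_ iAA _ nAA _] := G_fine.
apply: (null_shrinks nAA iAA AAA) => B; apply: contrapT => uAB.
apply: norep; exists A, B; split => // N; apply: contrapT => noN.
by apply: uAB; exists N => // i Ni uiAB; apply: noN; exists i.
Qed.
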